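(* Let $L$ be a bounded lattice and $\to$ a preimplication on $L$. Then the map $a\mapsto\widehat{a}$ is (1) an embedding of $(L,\to)$ into $(\mathfrak{L}(\mathsf{FI}(L,\to)),\to_\vartriangleleft)$ (an injective map preserving $0$, $1$, $\wedge$, $\vee$ and $\to$), and (2) an isomorphism from $L$ to the subalgebra of $(\mathfrak{L}(\mathsf{FI}(L,\to)),\to_\vartriangleleft)$ consisting of the $c_\vartriangleleft$-fixpoints that are compact open in the space $\mathsf{S}(L)$.
   Context: A preimplication on a bounded lattice $L$ is a binary operation $\to$ with, for all $a,b,c$: $a=1\to a$; $a\to(a\to b)\le a\to b$; if $a\le b$ then $b\to c\le a\to c$; if $a\le b$ then $c\to a\le c\to b$. $\mathsf{FI}(L,\to)=(X,\vartriangleleft)$ where $X$ is the set of pairs $(F,I)$ with $F$ a filter of $L$, $I$ an ideal of $L$, such that for all $a,b\in L$, if $a\in F$ and $b\in I$ then $a\to b\in I$; and $(F,I)\vartriangleleft(F',I')$ iff $I\cap F'=\varnothing$. For $a\in L$, $\widehat{a}=\{(F,I)\in X\mid a\in F\}$. $\mathsf{S}(L)$ is $X$ with the topology generated by $\{\widehat{a}\mid a\in L\}$. Write $y\vartriangleright x$ for $x\vartriangleleft y$; $c_\vartriangleleft(A)=\{x\mid\forall x'\vartriangleleft x\ \exists x''\vartriangleright x':x''\in A\}$; $\mathfrak{L}(X,\vartriangleleft)$ is the lattice of $c_\vartriangleleft$-fixpoints ordered by inclusion (meet $\cap$, join $c_\vartriangleleft$ of union); $A\to_\vartriangleleft B=\{x\mid\forall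 x'\vartriangleleft x\,(x'\in A\Rightarrow\exists x''\vartriangleright x':x''\in B)\}$. *)

(* Defs.v *)
From HB Require Import structures.
From mathcomp Require Import all_boot all_order.
From mathcomp Require Import all_classical topology.

Set Implicit Arguments.
Unset Strict Implicit.
Unset Printing Implicit Defensive.

Import Order.TTheory.
Local Open Scope classical_set_scope.

Section LatticesWithImplication.
Context {d : Order.disp_t} {L : tbLatticeType d}.

Definition preimplication (imp : L -> L -> L) : Prop :=
  [/\ forall a, a = imp \top%O a,
      forall a b, (imp a (imp a b) <= imp a b)%O,
      forall a b c, (a <= b)%O -> (imp b c <= imp a c)%O &
      forall a b c, (a <= b)%O -> (imp c a <= imp c b)%O].

(* Lattice filters and ideals are nonempty, but not required to be proper. *)
Definition lattice_filter (F : set L) : Prop :=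
  [/\ F !=set0,
      forall a b, F a -> (a <= b)%O -> F b &
      forall a b, F a -> F b -> F (Order.meet a b)].

Definition lattice_ideal (I : set L) : Prop :=
  [/\ I !=set0,
      forall a b, I b -> (a <= b)%O -> I a &
      forall a b, I a -> I b -> I (Order.join a b)].

Definition subalgebra (imp : L -> L -> L) (S : set L) : Prop :=
  [/\ S \bot%O,
      S \top%O,
      forall a b, S a -> S b -> S (Order.meet a b),
      forall a b, S a -> S b -> S (Order.join a b) &
      forall a b, S a -> S b -> S (imp a b)].

End LatticesWithImplication.

Section Morphisms.
Context {d d' : Order.disp_t} {L : tbLatticeType d} {L' : tbLatticeType d'}.
Variables (imp : L -> L -> L) (imp' : L' -> L' -> L').

Definition homomorphism (f : L -> L') : Prop :=
  [/\ f \bot%O = \bot%O,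
      f \top%O = \top%O,
      {morph f : a b / Order.meet a b},
      {morph f : a b / Order.join a b} &
      {morph f : a b / imp a b >-> imp' a b}].

Definition embedding (f : L -> L') : Prop := injective f /\ homomorphism f.

Definition isomorphism_onto (S : set L') (f : L -> L') : Prop :=
  [/\ subalgebra imp' S, homomorphism f & set_bij [set: L] S f].

End Morphisms.

Section RelationalFrame.
Context {T : Type} (R : T -> T -> Prop).

(* [R x y] stands for x ◁ y. *)
Definition closureR (A : set T) : set T :=
  [set x | forall x', R x' x -> exists2 x'', R x' x'' & A x''].

Definition arrowR (A B : set T) : set T :=
  [set x | forall x', R x' x -> A x' -> exists2 x'', R x' x'' & B x''].

Lemma subset_closureR A : A `<=` closureR A.
Proof. by move=> x Ax x' x'x; exists x. Qed.

Lemma closureR_mono A B : A `<=` B -> closureR A `<=` closureR B.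
Proof. by move=> AB x Ax x' /Ax [x'' ? /AB]; exists x''. Qed.

Lemma closureR_idem A : closureR (closureR A) = closureR A.
Proof.
apply/seteqP; split; last exact: subset_closureR.
by move=> x cx x' /cx [x'' x'x'' /(_ _ x'x'')].
Qed.

Record fixpoint := Fixpoint_ {
  fixpoint_val :> set T;
  fixpointP : closureR fixpoint_val == fixpoint_val }.

HB.instance Definition _ := [isSub for fixpoint_val].
HB.instance Definition _ := [Choice of fixpoint by <:].

Lemma fixpointE (A : fixpoint) : closureR A = A.
Proof. exact/eqP/fixpointP. Qed.

Fact fixpoint_display : Order.disp_t. Proof. exact: Order.Disp tt tt. Qed.

Definition fixpoint_le (A B : fixpoint) : bool := `[< A `<=` B >].

Fact fixpoint_le_refl : reflexive fixpoint_le.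
Proof. by move=> A; apply/asboolP. Qed.

Fact fixpoint_le_anti : antisymmetric fixpoint_le.
Proof.
by move=> A B /andP[/asboolP AB /asboolP BA]; apply/val_inj/seteqP.
Qed.

Fact fixpoint_le_trans : transitive fixpoint_le.
Proof.
move=> B A C /asboolP AB /asboolP BC.
by apply/asboolP; exact: subset_trans BC.
Qed.

HB.instance Definition _ := Order.Le_isPOrder.Build fixpoint_display fixpoint
  fixpoint_le_refl fixpoint_le_anti fixpoint_le_trans.

Fact meet_subproof (A B : fixpoint) : closureR (A `&` B) == A `&` B.
Proof.
apply/eqP/seteqP; split; last exact: subset_closureR.
by move=> x cx; split; rewrite -fixpointE;
  apply: closureR_mono cx => y [].
Qed.

Fact closure_subproof (A : set T) : closureR (closureR A) == closureR A.
Proof. exact/eqP/closureR_idem. Qed.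

Fact top_subproof : closureR setT == setT.
Proof. by apply/eqP/seteqP; split => // x _ x' x'x; exists x. Qed.

Fact arrow_subproof (A B : fixpoint) : closureR (arrowR A B) == arrowR A B.
Proof.
apply/eqP/seteqP; split; last exact: subset_closureR.
move=> x cx x' /cx [x'' x'x'' /(_ _ x'x'')]; exact.
Qed.

Definition fixpoint_meet (A B : fixpoint) := Fixpoint_ (meet_subproof A B).
Definition fixpoint_join (A B : fixpoint) :=
  Fixpoint_ (closure_subproof (A `|` B)).
Definition fixpoint_arrow (A B : fixpoint) := Fixpoint_ (arrow_subproof A B).

Fact fixpoint_meetP (A B C : fixpoint) :
  (A <= fixpoint_meet B C)%O = (A <= B)%O && (A <= C)%O.
Proof.
apply/idP/andP => [/asboolP|[/asboolP AB /asboolP AC]].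
  by rewrite subsetI => -[AB AC]; split; apply/asboolP.
by apply/asboolP; rewrite subsetI.
Qed.

Fact fixpoint_joinP (A B C : fixpoint) :
  (fixpoint_join A B <= C)%O = (A <= C)%O && (B <= C)%O.
Proof.
apply/idP/andP => [/asboolP ABC|[/asboolP AC /asboolP BC]].
  by split; apply/asboolP => x ?; apply/ABC/subset_closureR; [left|right].
apply/asboolP; rewrite -[X in _ `<=` X]fixpointE.
by apply: closureR_mono => x [/AC|/BC].
Qed.

HB.instance Definition _ :=
  Order.POrder_MeetJoin_isLattice.Build fixpoint_display fixpoint
    fixpoint_meetP fixpoint_joinP.

Fact fixpoint_botP (A : fixpoint) : (Fixpoint_ (closure_subproof set0) <= A)%O.
Proof.
by apply/asboolP; rewrite -[X in _ `<=` X]fixpointE; apply: closureR_mono.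
Qed.

Fact fixpoint_topP (A : fixpoint) : (A <= Fixpoint_ top_subproof)%O.
Proof. exact/asboolP. Qed.

HB.instance Definition _ :=
  Order.hasBottom.Build fixpoint_display fixpoint fixpoint_botP.
HB.instance Definition _ :=
  Order.hasTop.Build fixpoint_display fixpoint fixpoint_topP.

End RelationalFrame.

Arguments fixpoint_arrow {T} R A B.

Section FilterIdealFrame.
Context {d : Order.disp_t} {L : tbLatticeType d} (imp : L -> L -> L).

Record FI := MkFI {
  FI_filter : set L;
  FI_ideal : set L;
  FI_filterP : lattice_filter FI_filter;
  FI_idealP : lattice_ideal FI_ideal;
  FI_impP : forall a b, FI_filter a -> FI_ideal b -> FI_ideal (imp a b) }.

Definition FI_rel (x y : FI) : Prop := FI_ideal x `&` FI_filter y = set0.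

Definition hat (a : L) : set FI := [set x | FI_filter x a].

HB.instance Definition _ := gen_eqMixin FI.
HB.instance Definition _ := gen_choiceMixin FI.

(* The subbase is {hat a | a in L}; the factory needs a pointed index type,
   hence indexing by [set FI] rather than by [L]. *)
HB.instance Definition _ := isSubBaseTopological.Build FI (range hat) id.

Definition compact_open_fixpoints : set (fixpoint FI_rel) :=
  [set A | compact (A : set FI) /\ open (A : set FI)].

End FilterIdealFrame.

Arguments FI_rel {d L} imp x y.
Arguments hat {d L} imp a.
Arguments compact_open_fixpoints {d L} imp A.

(* Main.v *)
Require Import Defs.
From mathcomp Require Import all_boot all_order.
From mathcomp Require Import all_classical topology.

Set Implicit Arguments.
Unset Strict Implicit.
Unset Printing Implicit Defensive.

Import Order.TTheory.
Local Open Scope classical_set_scope.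

(** The pairs (↑a, L), ({1}, ↓a) and (↑a, ↓(a → b)) always belong to FI(L, →);
    they suffice to separate elements of L, to show that each â is a fixpoint,
    and to show that a ↦ â preserves joins and →.  Every open set containing
    the point (↑a, L) contains all of â, so â is compact.  Conversely, for an
    open fixpoint A the elements c with ĉ ⊆ A form an ideal and these ĉ
    cover A; the cover is directed, so compactness of A yields A = ĉ for one
    such c. *)

Section FiltersAndIdeals.
Context {d : Order.disp_t} {L : tbLatticeType d}.
Implicit Types (a b : L) (F I : set L).

Lemma lattice_filter_top F : lattice_filter F -> F \top%O.
Proof. by move=> [[a Fa] Fup _]; exact: Fup Fa (lex1 a). Qed.

Lemma lattice_ideal_bot I : lattice_ideal I -> I \bot%O.
Proof. by move=> [[a Ia] Idown _]; exact: Idown Ia (le0x a). Qed.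

Lemma lattice_filter_up a : lattice_filter [set x | (a <= x)%O].
Proof.
split=> [|x y /= ax xy|x y /= ax ay]; first by exists a => /=.
  exact: le_trans xy.
by rewrite lexI ax.
Qed.

Lemma lattice_ideal_down a : lattice_ideal [set x | (x <= a)%O].
Proof.
split=> [|x y /= ya xy|x y /= xa ya]; first by exists a => /=.
  exact: le_trans ya.
by rewrite leUx xa.
Qed.

Lemma lattice_idealT : lattice_ideal [set: L].
Proof. by split=> //; exists \bot%O. Qed.

End FiltersAndIdeals.

Section Hat.
Context {d : Order.disp_t} {L : tbLatticeType d} (imp : L -> L -> L).
Implicit Types (a b c : L) (x y : FI imp) (A B : set (FI imp)).

Lemma FI_relP x y :
  FI_rel imp x y <-> forall a, FI_filter y a -> ~ FI_ideal x a.
Proof.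
split=> [xy a ya xa|xy]; first by have : set0 a by rewrite -xy.
by rewrite /FI_rel -subset0 => a [xa ya]; exact: xy ya xa.
Qed.

(** With the whole lattice as ideal, compatibility with [imp] is automatic. The point serves as a
    successor, where only its filter matters. *)
Definition up_point a : FI imp :=
  MkFI (lattice_filter_up a) lattice_idealT (fun _ _ _ _ => Logic.I).

Lemma FI_rel_up_point x a : ~ FI_ideal x a -> FI_rel imp x (up_point a).
Proof.
move=> xa; apply/FI_relP => b /= ab xb; apply: xa.
by have [_ Idown _] := FI_idealP x; exact: Idown xb ab.
Qed.

Lemma hat_up_point a : hat imp a (up_point a).
Proof. exact: lexx. Qed.

Lemma hat_mono a b : (a <= b)%O -> hat imp a `<=` hat imp b.
Proof.
by move=> ab x xa; have [_ Fup _] := FI_filterP x; exact: Fup xa ab.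
Qed.

Lemma hat_le a b : hat imp a `<=` hat imp b -> (a <= b)%O.
Proof. by move=> /(_ _ (hat_up_point a)). Qed.

Lemma hatT : hat imp \top%O = setT.
Proof.
by apply/seteqP; split=> // x _; exact: lattice_filter_top (FI_filterP x).
Qed.

Lemma hatI a b : hat imp (Order.meet a b) = hat imp a `&` hat imp b.
Proof.
apply/seteqP; split=> [x xab|x [xa xb]].
  by split; apply: hat_mono xab; [exact: leIl|exact: leIr].
by have [_ _ FI] := FI_filterP x; exact: FI.
Qed.

(** A predecessor [x'] of [x] cannot have both [a] and [b] in its ideal, which would then contain
    their join; whichever is missing yields an [up_point] successor. *)
Lemma hat_join_sub a b :
  hat imp (Order.join a b) `<=`
    closureR (FI_rel imp) (hat imp a `|` hat imp b).
Proof.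
move=> x xab x' /FI_relP /(_ _ xab) x'ab.
have [x'a|x'a] := pselect (FI_ideal x' a); last first.
  by exists (up_point a); [exact: FI_rel_up_point|left; exact: hat_up_point].
have [x'b|x'b] := pselect (FI_ideal x' b); last first.
  by exists (up_point b); [exact: FI_rel_up_point|right; exact: hat_up_point].
by have [_ _ IU] := FI_idealP x'; case: x'ab; exact: IU.
Qed.

(** Every ideal contains bottom, so a point whose filter contains bottom has no predecessor and lies
    in every closure vacuously. *)
Lemma hat_bot_sub A : closureR (FI_rel imp) A = A -> hat imp \bot%O `<=` A.
Proof.
move=> <- x x0 x' /FI_relP /(_ _ x0) [].
exact: lattice_ideal_bot (FI_idealP x').
Qed.

Lemma hat_join_sub_fixpoint a b A : closureR (FI_rel imp) A = A ->
  hat imp a `<=` A -> hat imp b `<=` A -> hat imp (Order.join a b) `<=` A.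
Proof.
move=> <- aA bA x /hat_join_sub.
rewrite -[X in _ -> X x]closureR_idem.
by apply: closureR_mono => y [/aA|/bA].
Qed.

(** Finite meets, with top for the empty one, make the subbase already a base. *)
Lemma finI_from_hat A : finI_from (range (hat imp)) id A -> range (hat imp) A.
Proof.
move=> [D Dhat <-]; rewrite bigcap_fset big_seq.
elim/big_ind: _ => [|B C [b _ <-] [c _ <-]|B DB].
- by exists \top%O => //; exact: hatT.
- by exists (Order.meet b c) => //; exact: hatI.
- exact/set_mem/Dhat.
Qed.

Lemma open_hat a : open (hat imp a).
Proof.
exists [set hat imp a]; last by rewrite bigcup_set1.
by move=> _ ->; apply: finI_from1; exists a.
Qed.

Lemma nbhs_hatP x A :
  nbhs x A <-> exists2 a, FI_filter x a & hat imp a `<=` A.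
Proof.
rewrite nbhsE; split=> [[_ [[D sD <-] [B DB Bx]] BA]|[a xa aA]]; last first.
  by exists (hat imp a) => //; split=> //; exact: open_hat.
have [b _ bB] := finI_from_hat (sD _ DB).
move: DB Bx; rewrite -{}bB => Db xb; exists b => //.
by move=> y yb; apply: BA; exists (hat imp b).
Qed.

Lemma compact_hat a : compact (hat imp a).
Proof.
(* [up_point a] is a cluster point of [F], since each of its neighbourhoods contains [hat imp a]. *)
move=> F FF Fa; exists (up_point a); split; first exact: hat_up_point.
move=> A B FA /nbhs_hatP[b ab bB].
have [x [Ax xa]] := filter_ex (filterI FA Fa).
by exists x; split=> //; apply: bB; exact: hat_mono xa.
Qed.

Lemma compact_open_hat A :
    closureR (FI_rel imp) A = A -> compact A -> open A ->
  exists a, A = hat imp a.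
Proof.
move=> clA /compact_near_coveringP cptA oA.
pose J := [set c | hat imp c `<=` A].
(* [G] is the filter of tails of [J], which is directed because [A] is a fixpoint. Compactness then
   makes [hat imp c] cover [A] for all [c] in some tail. *)
pose G := filter_from J (fun c => [set c' | J c' /\ (c <= c')%O]).
have GF : Filter G.
  apply: filter_from_filter => [|a b aA bA].
    by exists \bot%O; exact: hat_bot_sub.
  exists (Order.join a b); first exact: hat_join_sub_fixpoint.
  move=> c [cA abc]; split; split=> //.
    exact: le_trans (leUl _ _) abc.
  exact: le_trans (leUr _ _) abc.
have [x Ax|a aA] := cptA L G (hat imp) GF.
  have /nbhs_hatP[a xa aA] : nbhs x A by exact: open_nbhs_nbhs.
  exists (hat imp a, [set c | J c /\ (a <= c)%O]) => /=.
    by split; [apply/nbhs_hatP; exists a|exists a].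
  by move=> [y c] [/= ya [_ ac]]; exact: hat_mono ya.
move=> /(_ a) /= Aa; exists a; apply/seteqP; split=> //.
by apply: Aa; split=> //; exact: lexx.
Qed.

Hypothesis Himp : preimplication imp.

(** Monotonicity reduces the compatibility condition on (↑a, ↓e) to its extreme case: b → c ≤ a → c
    ≤ a → e ≤ e. *)
Lemma principal_FI_impP a e : (imp a e <= e)%O ->
  forall b c, (a <= b)%O -> (c <= e)%O -> (imp b c <= e)%O.
Proof.
have [_ _ impl impr] := Himp.
move=> ae b c ab ce; apply: le_trans ae.
exact: le_trans (impl _ _ _ ab) (impr _ _ _ ce).
Qed.

Definition principal_point a e (ae : (imp a e <= e)%O) : FI imp :=
  MkFI (lattice_filter_up a) (lattice_ideal_down e) (principal_FI_impP ae).

Lemma hat_fixpoint a : closureR (FI_rel imp) (hat imp a) == hat imp a.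
Proof.
have [imp1 _ _ _] := Himp.
apply/eqP/seteqP; split; last exact: subset_closureR.
move=> x cx; apply: contrapT => xa.
(* This makes ({1}, ↓a) a point. It precedes [x] when [a] is outside the filter of [x], yet none of
   its successors lies in [hat imp a]. *)
have aa : (imp \top a <= a)%O by rewrite -imp1.
have [|y /FI_relP ya /ya] := cx (principal_point aa).
  by apply/FI_relP => b xb /= ba; apply: xa; have [_ Fup _] := FI_filterP x;
    exact: Fup xb ba.
by apply; exact: lexx.
Qed.

Lemma hat_imp a b :
  hat imp (imp a b) = arrowR (FI_rel imp) (hat imp a) (hat imp b).
Proof.
have [imp1 impK impl _] := Himp.
apply/seteqP; split=> [x xab x' /FI_relP /(_ _ xab) x'ab x'a|x xab].
  exists (up_point b); last exact: hat_up_point.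
  by apply: FI_rel_up_point => /(FI_impP x'a).
apply: contrapT => nxab.
(* The contraction axiom is exactly what makes (↑a, ↓(a → b)) a point. *)
have [||y /FI_relP yb /yb] := xab (principal_point (impK a b)).
- apply/FI_relP => c xc /= cab; apply: nxab.
  by have [_ Fup _] := FI_filterP x; exact: Fup xc cab.
- exact: lexx.
(* Since b = 1 → b ≤ a → b, the ideal contains [b], so no successor has [b] in its filter. *)
- by apply; rewrite /= {1}(imp1 b); exact: impl _ _ _ (lex1 a).
Qed.

Definition hat_fix a : fixpoint (FI_rel imp) := Fixpoint_ (hat_fixpoint a).

Lemma hat_fix_inj : injective hat_fix.
Proof.
move=> a b /(congr1 val) /= ab.
by apply: le_anti; apply/andP; split; apply: hat_le; rewrite ab.
Qed.

Lemma hat_fix_homomorphism :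
  homomorphism imp (fixpoint_arrow (FI_rel imp)) hat_fix.
Proof.
split=> [| |a b|a b|a b]; apply: val_inj => /=.
- apply/seteqP; split; first by apply: hat_bot_sub; exact: closureR_idem.
  rewrite -[X in _ `<=` X](eqP (hat_fixpoint \bot%O)).
  exact: closureR_mono.
- exact: hatT.
- exact: hatI.
- apply/seteqP; split; first exact: hat_join_sub.
  rewrite -[X in _ `<=` X](eqP (hat_fixpoint _)).
  by apply: closureR_mono => x [|]; apply: hat_mono; [exact: leUl|exact: leUr].
- exact: hat_imp.
Qed.

Lemma compact_open_fixpointsE : compact_open_fixpoints imp = range hat_fix.
Proof.
apply/seteqP; split=> [A [cA oA]|_ [a _ <-]].
  have [a aA] := compact_open_hat (fixpointE A) cA oA.
  by exists a => //; exact: val_inj.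
by split; [exact: compact_hat|exact: open_hat].
Qed.

End Hat.

Lemma homomorphism_range_subalgebra {d d' : Order.disp_t}
    {L : tbLatticeType d} {L' : tbLatticeType d'}
    (imp : L -> L -> L) (imp' : L' -> L' -> L') (f : L -> L') :
  homomorphism imp imp' f -> subalgebra imp' (range f).
Proof.
move=> [f0 f1 fI fU fimp]; split=> [| |_ _ [a _ <-] [b _ <-]
    |_ _ [a _ <-] [b _ <-]|_ _ [a _ <-] [b _ <-]].
- by exists \bot%O.
- by exists \top%O.
- by exists (Order.meet a b).
- by exists (Order.join a b).
- by exists (imp a b).
Qed.

Theorem theoremB7 (d : Order.disp_t) (L : tbLatticeType d)
    (imp : L -> L -> L) (Himp : preimplication imp) :
  exists h : L -> fixpoint (FI_rel imp),
    [/\ forall a : L, fixpoint_val (h a) = hat imp a,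
        embedding imp (fixpoint_arrow (FI_rel imp)) h &
        isomorphism_onto imp (fixpoint_arrow (FI_rel imp))
          (compact_open_fixpoints imp) h].
Proof.
have hom := hat_fix_homomorphism Himp; have inj := @hat_fix_inj _ _ _ Himp.
exists (hat_fix Himp); split=> //.
(* Once the target is the range of [hat_fix], surjectivity is immediate and closure under the
   operations follows from the homomorphism property. *)
rewrite /isomorphism_onto (compact_open_fixpointsE Himp); split=> //.
  exact: homomorphism_range_subalgebra hom.
by split=> // a b _ _; exact: inj.
Qed.
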